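(* Let $M\neq\emptyset$, let $(M,\mathcal C)$ be a differential space such that $(M,\tau_{\mathcal C})$ is Hausdorff, and let $\mathcal G$ be a family of generators of $\mathcal C$, i.e. $\mathcal C=\mathrm{gen}(\mathcal G)$. Let $(\widetilde M,\widetilde{\mathcal U}_{\mathcal G})$ be the completion of the uniform space $(M,\mathcal U_{\mathcal G})$, with $M$ regarded as a dense subset of $\widetilde M$. Then every function $g\in\mathcal G$ possesses the continuous extension $\tilde g:\widetilde M\to\mathbb R$. If $\widetilde{\mathcal G}$ is the family of all continuous extensions to $\widetilde M$ of elements of $\mathcal G$, then the differential structure $\mathcal D=\mathrm{gen}(\widetilde{\mathcal G})$ on $\widetilde M$ is a continuous extension (with respect to the topology $\tau_{\widetilde{\mathcal U}_{\mathcal G}}$) of the differential structure $\mathcal C$ from the set $M$ to the set $\widetilde M$. Moreover $\tau_{\mathcal D}=\tau_{\widetilde{\mathcal U}_{\mathcal G}}$.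
   Context: Differential spaces (Sikorski). For a nonempty set $M$ and a family $\mathcal C$ of functions $M\to\mathbb R$, $\tau_{\mathcal C}$ is the weakest topology on $M$ making all functions of $\mathcal C$ continuous. $\mathcal C$ is a differential structure on $M$ if: (a) every $f:M\to\mathbb R$ such that each $m\in M$ has a $\tau_{\mathcal C}$-neighbourhood $V$ and some $\alpha\in\mathcal C$ with $f|_V=\alpha|_V$ belongs to $\mathcal C$; and (b) $\omega\circ(\alpha_1,\dots,\alpha_n)\in\mathcal C$ for all $n\in\mathbb N$, $\omega\in C^\infty(\mathbb R^n)$, $\alpha_1,\dots,\alpha_n\in\mathcal C$. Then $(M,\mathcal C)$ is a differential space. For a family $\mathcal F$ of real functions on $M$, $\mathrm{gen}(\mathcal F)$ is the smallest differential structure on $M$ containing $\mathcal F$. If $\mathcal D$ is a differential structure on $N$ and $\emptyset\ne M\subset N$, then $\mathcal D_M$ is the differential structure on $M$ generated by the restrictions $\{\alpha|_M:\alpha\in\mathcal D\}$. $\mathcal D$ is an extension of a differential structure $\mathcal C$ from $M$ to $N$ if $\mathcal C=\mathcal D_M$; the extension is continuous with respect to a topology $\tau$ on $N$ if each $f\in\mathcal D$ is $\tau$-continuous (i.e. $\tau_{\mathcal D}\subset\tau$). If $(M,\tau_{\mathcal C})$ is Hausdorff (equivalently, $\mathcal G$ separates points), $\mathcal U_{\mathcal G}$ is the uniform structure on $M$ with base consisting of the sets $\{(x,y)\in M\times M: |f_i(x)-f_i(y)|<\varepsilon,\ i=1,\dots,k\}$, $k\in\mathbb N$, $f_1,\dots,f_k\in\mathcal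 G$, $\varepsilon>0$. The completion of a uniform space is the standard Hausdorff completion (points: minimal Cauchy filters), unique up to uniform homeomorphism; $\tau_{\mathcal U}$ denotes the topology induced by a uniform structure $\mathcal U$. *)

(* Defs.v *)
From HB Require Import structures.
From mathcomp Require Import all_boot all_order all_algebra.
From mathcomp Require Import all_classical all_reals all_analysis.

Set Implicit Arguments.
Unset Strict Implicit.
Unset Printing Implicit Defensive.

Import Order.TTheory GRing.Theory Num.Theory.
Import numFieldNormedType.Exports.

Local Open Scope classical_set_scope.
Local Open Scope ring_scope.

Section Smooth.
Variable R : realType.

(* delta_mx 0 j is the j-th vector of the standard basis. *)
Definition partial n (j : 'I_n) (f : 'rV[R]_n -> R) : 'rV[R]_n -> R :=
  fun x => 'D_(delta_mx 0 j) f x.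

Fixpoint Ck (k : nat) n (f : 'rV[R]_n -> R) : Prop :=
  continuous f /\
  if k is k'.+1 then
    forall j : 'I_n,
      (forall x, derivable f x (delta_mx 0 j)) /\ Ck k' (partial j f)
  else True.

Definition smooth n (f : 'rV[R]_n -> R) : Prop := forall k, Ck k f.

End Smooth.

Section FunTop.
Variables (R : realType) (M : choiceType).

(* The set M with the topology tau_C, obtained as the supremum of the initial
   topologies of the members of C. *)
Definition fun_top (C : set (M -> R)) : Type :=
  sup_topology (fun f : {f : M -> R | C f} =>
    Topological.class (initial_topology (sval f))).

HB.instance Definition _ (C : set (M -> R)) := Topological.on (fun_top C).

Definition tau (C : set (M -> R)) : set (set M) := @open (fun_top C).

(* The arity n may be 0, so that every differential structure contains the
   constant functions. *)
Definition diff_structure (C : set (M -> R)) : Prop :=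
  (forall f : M -> R,
     (forall m : M, exists (V : set M) (a : M -> R),
        [/\ nbhs (m : fun_top C) V, C a & forall x, V x -> f x = a x]) ->
     C f) /\
  (forall (n : nat) (w : 'rV[R]_n -> R) (a : 'I_n -> M -> R),
     smooth w -> (forall i, C (a i)) ->
     C (fun m => w (\row_i a i m))).

Definition gen (F : set (M -> R)) : set (M -> R) := smallest diff_structure F.

End FunTop.

Section Extension.
Variables (R : realType) (M N : choiceType) (i : M -> N).

(* The subset M of N is given by an injection i, so that the restriction of
   a : N -> R to M is a \o i. *)
Definition restr_structure (D : set (N -> R)) : set (M -> R) :=
  gen [set a \o i | a in D].

Definition is_extension (C : set (M -> R)) (D : set (N -> R)) : Prop :=
  [/\ diff_structure C, diff_structure D & C = restr_structure D].

End Extension.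

Definition is_continuous_extension (R : realType) (M : choiceType)
    (N : topologicalType) (i : M -> N) (C : set (M -> R)) (D : set (N -> R)) :=
  is_extension i C D /\ (forall f : N -> R, D f -> continuous f).

Section FunUnif.
Local Open Scope relation_scope.
Variables (R : realType) (M : choiceType).

(* The set M with the uniformity U_G. In fun_ent, k = 0 gives the total
   relation, so that the sets form a base even if G is empty. *)
Definition fun_unif (G : set (M -> R)) : Type := M.

Variable G : set (M -> R).

Definition fun_ent : set_system (M * M) :=
  [set E | exists (k : nat) (f : 'I_k -> M -> R) (e : R),
    [/\ forall i, G (f i), 0 < e &
        [set xy | forall i, `|f i xy.1 - f i xy.2| < e] `<=` E]].

Let fun_ent_filter : Filter fun_ent.
Proof.
split.
- by exists 0%N, (fun _ _ => 0), 1; split=> // -[].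
- move=> P Q [k [f [e [Gf e0 fP]]]] [l [g [d [Gg d0 gQ]]]].
  exists (k + l)%N,
    (fun i : 'I_(k + l) => match fintype.split i with inl a => f a | inr b => g b end),
    (Num.min e d); split.
  + by move=> i; case: (fintype.split i).
  + by rewrite lt_min e0.
  + move=> xy /= H; split; [apply: fP|apply: gQ] => /= i.
    * have := H (lshift l i); rewrite -[lshift l i]/(unsplit (inl i)) unsplitK.
      by rewrite lt_min => /andP[].
    * have := H (rshift k i); rewrite -[rshift k i]/(unsplit (inr i)) unsplitK.
      by rewrite lt_min => /andP[].
- move=> P Q PQ [k [f [e [Gf e0 fP]]]]; exists k, f, e; split=> //.
  exact: subset_trans PQ.
Qed.

Let fun_ent_refl A : fun_ent A -> diagonal `<=` A.
Proof.
move=> [k [f [e [Gf e0 fA]]]] [x y] /diagonalP <-; apply: fA => i /=.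
by rewrite subrr normr0.
Qed.

Let fun_ent_inv A : fun_ent A -> fun_ent A^-1.
Proof.
move=> [k [f [e [Gf e0 fA]]]]; exists k, f, e; split=> // -[x y] /= H.
by apply: fA => i /=; rewrite distrC.
Qed.

Let fun_ent_split A : fun_ent A -> exists2 B, fun_ent B & B \; B `<=` A.
Proof.
move=> [k [f [e [Gf e0 fA]]]].
exists [set xy | forall i, `|f i xy.1 - f i xy.2| < e / 2].
  by exists k, f, (e / 2); split=> //; rewrite divr_gt0.
move=> [x y] [z /= xz zy]; apply: fA => i /=.
rewrite -(subrK (f i z) (f i x)) -addrA (le_lt_trans (ler_normD _ _))//.
by rewrite [ltRHS]splitr ltrD.
Qed.

HB.instance Definition _ := Choice.on (fun_unif G).
HB.instance Definition _ := @isUniform.Build (fun_unif G) fun_ent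
  fun_ent_filter fun_ent_refl fun_ent_inv fun_ent_split.

End FunUnif.

(* completeType is not used for V because it also carries a chosen point. *)
Definition is_completion (U V : uniformType) (i : U -> V) : Prop :=
  [/\ injective i,
      @entourage U = @entourage (initial_topology i),
      dense (range i),
      hausdorff_space V &
      forall F : set_system V, ProperFilter F -> cauchy F -> exists v : V, F --> v].

(* The space of minimal Cauchy filters is a completion of every Hausdorff
   uniform space, so that is_completion is inhabited. *)
Section MinimalCauchy.
Local Open Scope relation_scope.
Variable U : uniformType.

Definition minimal_cauchy (F : set_system U) : Prop :=
  [/\ ProperFilter F, cauchy F &
      forall G : set_system U, ProperFilter G -> cauchy G ->
        G `<=` F -> G = F].

Definition mcf : Type := {F : set_system U | minimal_cauchy F}.

HB.instance Definition _ := gen_eqMixin mcf.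
HB.instance Definition _ := gen_choiceMixin mcf.

Local Instance mcf_filter (F : mcf) : ProperFilter (sval F).
Proof. by case: F => F []. Qed.

Lemma mcf_inj (F G : mcf) : sval F = sval G -> F = G.
Proof. by case: F G => [F PF] [G PG] /= E; exact: eq_exist. Qed.

Definition small (E : set (U * U)) (A : set U) := A `*` A `<=` E.

Lemma cauchy_smallP (F : set_system U) : Filter F ->
  cauchy F <-> forall E, entourage E -> exists2 A, F A & small E A.
Proof.
move=> FF; split=> [cF E /cF[[P Q] /= [FP FQ] PQ]|cF E /cF[A FA AE]].
  exists (P `&` Q); first exact: filterI.
  by move=> [x y] /= [[Px _] [_ Qy]]; exact: (PQ (x, y)).
by exists (A, A).
Qed.

Lemma ent_sym3 (E : set (U * U)) : entourage E ->
  exists E', [/\ entourage E', forall x y, E' (x, y) -> E' (y, x) &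
    forall x y z t, E' (x, y) -> E' (y, z) -> E' (z, t) -> E (x, t)].
Proof.
move=> /entourage_split_ex[A entA AE].
have [B entB BA] := entourage_split_ex entA.
exists (B `&` B^-1); split; first exact: entourage_invI.
  by move=> x y [].
move=> x y z t [xy _] [yz _] [zt _]; apply: AE; exists z.
  by apply: BA; exists y.
by apply: BA; exists t => //; exact: entourage_refl.
Qed.

Definition fatten (E : set (U * U)) (A : set U) : set U :=
  [set y | exists2 x, A x & E (x, y)].

Lemma sub_fatten E A : entourage E -> A `<=` fatten E A.
Proof. by move=> entE x Ax; exists x => //; exact: entourage_refl. Qed.

Lemma small_fatten E E' A :
  (forall x y, E' (x, y) -> E' (y, x)) ->
  (forall x y z t, E' (x, y) -> E' (y, z) -> E' (z, t) -> E (x, t)) ->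
  small E' A -> small E (fatten E' A).
Proof.
move=> sE' E'E sA [x y] /= [[a Aa ax] [b Ab yb]].
by apply: (E'E _ a b) => //; [exact: sE'|exact: (sA (a, b))].
Qed.

Definition mcf_rel (E : set (U * U)) : set (mcf * mcf) :=
  [set FG | exists A, [/\ sval FG.1 A, sval FG.2 A & small E A]].

Definition mcf_ent : set_system (mcf * mcf) := filter_from entourage mcf_rel.

Let mcf_ent_filter : Filter mcf_ent.
Proof.
apply: filter_from_filter; first by exists setT; exact: filterT.
move=> A B entA entB; exists (A `&` B); first exact: filterI.
by move=> FG [S [FS GS SAB]]; split; exists S; split=> // x /SAB[].
Qed.

Let mcf_ent_refl A : mcf_ent A -> diagonal `<=` A.
Proof.
move=> [E entE EA] [F G] /diagonalP <-; apply: EA.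
case: F => F /= [FF cF mF]; have [S FS SE] := (cauchy_smallP _).1 cF _ entE.
by exists S.
Qed.

Let mcf_ent_inv A : mcf_ent A -> mcf_ent A^-1.
Proof.
move=> [E entE EA]; exists E => // -[F G] [S /= [FS GS SE]].
by apply: EA; exists S.
Qed.

Let mcf_ent_split A : mcf_ent A -> exists2 B, mcf_ent B & B \; B `<=` A.
Proof.
move=> [E entE EA]; have [E' [entE' sE' E'E]] := ent_sym3 entE.
exists (mcf_rel E'); first by exists E'.
move=> [F G] [H [/= S [FS HS SE]] [/= T [HT GT TE]]]; apply: EA.
exists (S `|` T); split=> /=.
- by apply: filterS FS; exact: subsetUl.
- by apply: filterS GT; exact: subsetUr.
have [z [Sz Tz]] := filter_ex (filterI HS HT).
have H1 x : (S `|` T) x -> E' (x, z).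
  by move=> [Sx|Tx]; [exact: (SE (x, z))|exact: (TE (x, z))].
move=> [x y] /= [/H1 xz /H1/sE' zy]; apply: (E'E _ z z) => //.
exact: entourage_refl.
Qed.

HB.instance Definition _ := @isUniform.Build mcf mcf_ent
  mcf_ent_filter mcf_ent_refl mcf_ent_inv mcf_ent_split.

Lemma nbhs_minimal_cauchy (x : U) : minimal_cauchy (nbhs x).
Proof.
split.
- exact: nbhs_pfilter.
- apply/cauchy_smallP => E entE; have [E' [entE' sE' E'E]] := ent_sym3 entE.
  exists (xsection E' x); first exact: nbhs_entourage.
  move=> [y z] /= [/xsectionP xy /xsectionP xz].
  by apply: (E'E _ x x) => //; [exact: sE'|exact: entourage_refl].
- move=> G PG cG Gx; apply/seteqP; split=> // A.
  rewrite -nbhs_entourageE => -[E entE EA].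
  have [B GB BE] := (cauchy_smallP _).1 cG _ entE.
  apply: (filterS _ GB) => y By; apply: EA; apply/xsectionP; apply: (BE (x, y)).
  by split=> //=; exact: nbhs_singleton (Gx _ GB).
Qed.

Definition mcf_embed (x : U) : mcf := exist _ _ (nbhs_minimal_cauchy x).

Definition minimize (F : set_system U) : set_system U :=
  [set B | exists A E, [/\ F A, entourage E & fatten E A `<=` B]].

Lemma minimize_sub F : Filter F -> minimize F `<=` F.
Proof.
move=> FF B [A [E [FA entE AB]]]; apply: filterS FA.
exact: subset_trans (sub_fatten entE) AB.
Qed.

Lemma minimize_filter F : ProperFilter F -> ProperFilter (minimize F).
Proof.
move=> FF; apply: Build_ProperFilter_ex.
  by move=> B /minimize_sub FB; exact: (@filter_ex _ F).
split.
- by exists setT, setT; split=> //; exact: filterT.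
- move=> P Q [A [E [FA entE AP]]] [B [D [FB entD BQ]]].
  exists (A `&` B), (E `&` D); split; [exact: filterI|exact: filterI|].
  by move=> y [x [Ax Bx] [Exy Dxy]]; split; [apply: AP|apply: BQ]; exists x.
- move=> P Q PQ [A [E [FA entE AP]]]; exists A, E; split=> //.
  exact: subset_trans PQ.
Qed.

Lemma minimize_minimal F : ProperFilter F -> cauchy F ->
  minimal_cauchy (minimize F).
Proof.
move=> FF cF; have mF := minimize_filter FF; split=> //.
- apply/cauchy_smallP => E entE; have [E' [entE' sE' E'E]] := ent_sym3 entE.
  have [A FA AE] := (cauchy_smallP _).1 cF _ entE'.
  exists (fatten E' A); last exact: (small_fatten sE' E'E AE).
  by exists A, E'; split.
- move=> G PG cG GF; apply/seteqP; split=> // B [A [E [FA entE AB]]].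
  have [S GS SE] := (cauchy_smallP _).1 cG _ entE.
  have [x [Ax Sx]] := filter_ex (filterI FA (minimize_sub _ (GF _ GS))).
  apply: filterS GS => y Sy; apply: AB; exists x => //.
  exact: (SE (x, y)).
Qed.

Lemma mcf_hausdorff : hausdorff_space mcf.
Proof.
move=> F G FG.
have key E : entourage E -> exists A, [/\ sval F A, sval G A & small E A].
  move=> entE.
  have entM : mcf_ent (mcf_rel E) by exists E.
  have [B entB BE] := mcf_ent_split entM.
  have nF : nbhs F (xsection B F) by exact: (@nbhs_entourage mcf).
  have nG : nbhs G (xsection B^-1 G).
    by apply: (@nbhs_entourage mcf); exact: (@entourage_inv mcf).
  have [H [/xsectionP FH /xsectionP HG]] := FG _ _ nF nG.
  by apply: (BE (F, G)); exists H.
have PF := mcf_filter F; have PG := mcf_filter G.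
pose K : set_system U := [set A | sval F A /\ sval G A].
have PK : ProperFilter K.
  apply: Build_ProperFilter_ex; first by move=> A [/filter_ex].
  split; first by split; exact: filterT.
  - by move=> P Q [? ?] [? ?]; split; exact: filterI.
  - by move=> P Q PQ [FP GP]; split; apply: filterS PQ _.
have cK : cauchy K.
  by apply/cauchy_smallP => E /key[A [FA GA AE]]; exists A.
apply: mcf_inj; have [_ _ mF] := svalP F; have [_ _ mG] := svalP G.
have KF : K = sval F by apply: mF => // A [].
have KG : K = sval G by apply: mG => // A [].
exact: etrans (esym KF) KG.
Qed.

Lemma mcf_embed_inj : hausdorff_space U -> injective mcf_embed.
Proof.
move=> hU x y /(congr1 sval)/= xy; apply: hU => A B Ax By.
by apply: (@filter_ex _ (nbhs x)); apply: filterI => //; rewrite xy.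
Qed.

Lemma mcf_embed_ent : @entourage U = @entourage (initial_topology mcf_embed).
Proof.
apply/seteqP; split=> E.
  move=> entE; exists (mcf_rel E); first by exists E.
  move=> [x y] [A /= [xA yA AE]]; apply: (AE (x, y)).
  by split; exact: nbhs_singleton.
move=> [E0 [E1 entE1 E1E] EE].
have [E2 [entE2 sE2 E2E1]] := ent_sym3 entE1.
have [E3 [entE3 sE3 E3E2]] := ent_sym3 entE2.
suff sub : E3 `<=` E by exact: (filterS sub entE3).
move=> [x y] xy; apply: EE; apply: E1E => /=.
exists (xsection E2 x); split=> /=.
- exact: nbhs_entourage.
- rewrite -nbhs_entourageE; exists E3 => // z /xsectionP yz.
  apply/xsectionP; apply: (E3E2 _ x y) => //; exact: entourage_refl.
- move=> [a b] /= [/xsectionP xa /xsectionP xb].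
  by apply: (E2E1 _ x x) => //; [exact: sE2|exact: entourage_refl].
Qed.

Lemma mcf_embed_dense : dense (range mcf_embed).
Proof.
move=> O [F OF] oO.
have : nbhs F O by exact: open_nbhs_nbhs.
rewrite -nbhs_entourageE => -[E0 [E entE EE] EO].
have [E' [entE' sE' E'E]] := ent_sym3 entE.
have PF := mcf_filter F; have [_ cF _] := svalP F.
have [A FA AE] := (cauchy_smallP _).1 cF _ entE'.
have [x Ax] := filter_ex FA.
exists (mcf_embed x); split; last by exists x.
apply: EO; apply/xsectionP; apply: EE; exists (fatten E' A); split=> /=.
- by apply: filterS FA; exact: sub_fatten.
- rewrite -nbhs_entourageE; exists E' => // y /xsectionP xy.
  by exists x.
- exact: (small_fatten sE' E'E AE).
Qed.

Lemma mcf_complete (P : set_system mcf) : ProperFilter P -> cauchy P ->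
  exists F : mcf, P --> F.
Proof.
move=> PP cP.
have key E : entourage E ->
    exists2 B, small E B & P [set F | sval F B].
  move=> entE; have [E' [entE' sE' E'E]] := ent_sym3 entE.
  have [|[S T] /= [PS PT] ST] := cP (mcf_rel E'); first by exists E'.
  have [F [SF TF]] := filter_ex (filterI PS PT).
  have PF := mcf_filter F.
  have [A [/= FA _ AE]] := ST (F, F) (conj SF TF).
  exists (fatten E' A); first exact: (small_fatten sE' E'E AE).
  apply: filterS PT => G TG; have PG := mcf_filter G.
  have [B [/= FB GB BE]] := ST (F, G) (conj SF TG).
  have [x [Ax Bx]] := filter_ex (filterI FA FB).
  by apply: filterS GB => y By; exists x => //; exact: (BE (x, y)).
pose F0 : set_system U := [set B | P [set F | sval F B]].
have PF0 : ProperFilter F0.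
  apply: Build_ProperFilter_ex.
    move=> B PB; have [F /= FB] := filter_ex (PB : P [set F | sval F B]).
    exact: filter_ex FB.
  split.
  - by apply: (@nearW _ P) => F /=; have PF := mcf_filter F; exact: filterT.
  - move=> A B FA FB; apply: (filterS _ (@filterI _ P _ _ _ FA FB)) => F [/= ? ?].
    by have PF := mcf_filter F; exact: filterI.
  - move=> A B AB; apply: (@filterS _ P) => F /= FA; have PF := mcf_filter F.
    exact: filterS AB FA.
have cF0 : cauchy F0.
  by apply/cauchy_smallP => E /key[B BE PB]; exists B.
exists (exist _ _ (minimize_minimal PF0 cF0)) => A.
rewrite -nbhs_entourageE => -[E0 [E entE EE] EA].
have [E' [entE' sE' E'E]] := ent_sym3 entE.
have [B BE PB] := key _ entE'.
apply: (filterS _ PB) => G /= GB; apply: EA; apply/xsectionP; apply: EE.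
have PG := mcf_filter G.
exists (fatten E' B); split=> /=.
- by exists B, E'; split.
- by apply: filterS GB; exact: sub_fatten.
- exact: (small_fatten sE' E'E BE).
Qed.

Lemma mcf_completion : hausdorff_space U -> is_completion mcf_embed.
Proof.
move=> hU; split; [exact: mcf_embed_inj|exact: mcf_embed_ent|
  exact: mcf_embed_dense|exact: mcf_hausdorff|exact: mcf_complete].
Qed.

End MinimalCauchy.

(* Main.v *)
(* The members of G are uniformly continuous for U_G, hence extend to the
   completion.  Both {f | f is continuous} and {f | f \o i is in C} are
   differential structures on the completion containing the extensions, so
   they contain D.  The extensions of the members of G already induce the
   topology of the completion, as the uniformity is determined on the dense
   subset M. *)

Require Import Defs.
From mathcomp Require Import all_boot all_order all_algebra.
From mathcomp Require Import all_classical all_reals all_analysis.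
From mathcomp Require Import lra.
Import numFieldNormedType.Exports.
Local Open Scope classical_set_scope.
Import Order.TTheory GRing.Theory Num.Theory.

(** * Extension of maps from a dense subspace *)

Lemma dense_range_nbhs {S : Type} {V : topologicalType} (i : S -> V) (v : V)
    (A : set V) :
  dense (range i) -> nbhs v A -> exists x, A (i x).
Proof.
move=> di; rewrite nbhsE => -[B [oB Bv] BA].
have [|y [By [x _ ixy]]] := di B _ oB; first by exists v.
by exists x; apply: BA; rewrite ixy.
Qed.

Lemma dense_range_continuous_inj {S : Type} {V T : topologicalType} (i : S -> V)
    (g h : V -> T) :
  dense (range i) -> hausdorff_space T -> continuous g -> continuous h ->
  g \o i = h \o i -> g = h.
Proof.
move=> di hT cg ch gh; apply/funext => v; apply: hT => A B gA hB.
have vAB : nbhs v (g @^-1` A `&` h @^-1` B).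
  by apply: filterI; [exact: cg|exact: ch].
have [x [Ax Bx]] := dense_range_nbhs i v _ di vAB.
exists (g (i x)); split=> //.
by rewrite (congr1 (@^~ x) gh : g (i x) = h (i x)).
Qed.

(** The value at [v] is the limit of [f] along the trace on [U] of the neighbourhoods of [v].
    Density makes this trace a proper filter, and uniform continuity of [f] makes its image Cauchy,
    because the entourages of [U] are pulled back from [V]. *)
Lemma dense_uniform_extension {U V : uniformType} {T : completeType}
    (i : U -> V) (f : U -> T) :
  @entourage U = @entourage (initial_topology i) -> dense (range i) ->
  hausdorff_space T -> unif_continuous f ->
  exists2 g : V -> T, continuous g & g \o i = f.
Proof.
move=> eU di hT uf.
have fE E : entourage E ->
    exists2 D, entourage D & forall x y, D (i x, i y) -> E (f x, f y).
  move=> /uf; rewrite /= /nbhs /= eU => -[D entD DE].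
  by exists D => // x y Dxy; exact: (DE (x, y)).
pose trace (v : V) : set_system U := filter_from (nbhs v) (preimage i).
have trace_proper v : ProperFilter (trace v).
  apply: filter_from_proper; last first.
    by move=> A vA; have [x Ax] := dense_range_nbhs i v A di vA; exists x.
  apply: filter_from_filter; first by exists setT; exact: filterT.
  by move=> A B vA vB; exists (A `&` B) => //; exact: filterI.
have trace_cauchy v : cauchy (f @ trace v).
  apply/cauchy_smallP => E /fE[D entD DE].
  have [D' [entD' sD' D'D]] := ent_sym3 entD.
  exists (f @` (i @^-1` xsection D' v)).
    exists (xsection D' v); first exact: nbhs_entourage.
    by move=> x vx; exists x.
  move=> [_ _] [/= [x /xsectionP vx <-] [y /xsectionP vy <-]].
  by apply/DE/(D'D _ v v) => //; [exact: sD'|exact: entourage_refl].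
pose g (v : V) := lim (f @ trace v).
have g_lim v : f @ trace v --> g v by exact: cauchy_cvg.
exists g.
  move=> v; apply/cvg_entourageP => E entE.
  have [E' [entE' sE' E'E]] := ent_sym3 entE.
  have [D entD DE'] := fE _ entE'; have [D' [entD' sD' D'D]] := ent_sym3 entD.
  (* Each [w] gets a witness in [U] that is close to it and whose value under [f] is close to [g w].
     For [w] close to [v], the two witnesses are [D]-close, so [g v] and [g w] are compared through
     their values under [f]. *)
  have near_g (w : V) : exists x, D' (w, i x) /\ E' (g w, f x).
    have H1 : trace w [set x | D' (w, i x)].
      exists (xsection D' w); first exact: nbhs_entourage.
      by move=> x /xsectionP.
    have H2 : trace w [set x | E' (g w, f x)].
      have /= := (cvg_entourageP _ _).1 (g_lim w) _ entE'; exact.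
    have [x [H3 H4]] := filter_ex (filterI H1 H2); by exists x.
  have [x [vx gvx]] := near_g v.
  have : nbhs v (xsection D' v) by exact: nbhs_entourage.
  apply: filterS => w /xsectionP vw; have [y [wy gwy]] := near_g w.
  apply: (E'E _ (f x) (f y)) => //; last exact: sE'.
  by apply/DE'/(D'D _ v w) => //; exact: sD'.
(* Along the trace at [i x], [f] also converges to [f x], and limits in [T] are unique. *)
apply/funext => x; apply: (@cvg_unique _ hT (f @ trace (i x))); first exact: g_lim.
apply/cvg_entourageP => E /fE[D entD DE].
exists (xsection D (i x)); first exact: nbhs_entourage.
by move=> y /xsectionP xy; exact: DE.
Qed.

(** * Weak topologies and differential structures *)

Section FunTopTheory.
Context {R : realType} {M : choiceType}.
Implicit Types C F : set (M -> R).

Lemma fun_top_continuous C (f : M -> R) :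
  C f -> continuous (f : fun_top C -> R).
Proof.
move=> Cf m A fA.
have /cvg_sup : (nbhs (m : fun_top C) : set_system M) --> (m : fun_top C) by [].
by move=> /(_ (exist _ f Cf)) H; apply: H; exact: (initial_continuous fA).
Qed.

Lemma cvg_fun_top C (F : set_system M) (m : M) : Filter F ->
  (forall f, C f -> f @ F --> f m) -> F --> (m : fun_top C).
Proof.
move=> FF H; apply/cvg_sup => -[f Cf] /= A [_ [[B oB <-] Bm BA]].
by apply: filterS BA _; apply: (H f Cf); exact: open_nbhs_nbhs.
Qed.

Lemma continuous_fun_top C {T : topologicalType} (h : T -> M) :
  (forall f, C f -> continuous (f \o h)) -> continuous (h : T -> fun_top C).
Proof. by move=> H t; apply: cvg_fun_top => f Cf; exact: H. Qed.

(** For locality, let [D] be a differential structure containing [F]. It contains [gen F], so its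
    topology is finer, and neighbourhoods for [gen F] remain neighbourhoods for [D]. *)
Lemma diff_structure_gen F : diff_structure (gen F).
Proof.
split=> [f fP D [sD FD]|n w a sw aP D [sD FD]]; last first.
  by apply: sD.2 => // k; exact: aP.
apply: sD.1 => m; have [V [a [mV Fa fa]]] := fP m.
exists V, a; split=> //; last exact: Fa.
suff: continuous (id : fun_top D -> fun_top (gen F)) by move=> /(_ m); exact.
by apply: continuous_fun_top => h Fh; apply: fun_top_continuous; exact: Fh.
Qed.

End FunTopTheory.

(** The map [i] is continuous for the two weak topologies, so a local representation near [i m]
    pulls back to one near [m]. *)
Lemma diff_structure_pullback {R : realType} {M N : choiceType} (i : M -> N)
    (C : set (M -> R)) :
  diff_structure C -> diff_structure [set a : N -> R | C (a \o i)].
Proof.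
move=> [locC compC]; split=> [f fP|n w a sw aP] /=; last exact: compC.
apply: locC => m; have [V [a [mV Ca fa]]] := fP (i m).
exists (i @^-1` V), (a \o i); split=> // [|x /fa //].
suff: continuous (i : fun_top C -> fun_top [set a : N -> R | C (a \o i)]).
  by move=> /(_ m); exact.
by apply: continuous_fun_top => h Ch; exact: fun_top_continuous.
Qed.

Lemma continuous_row {R : realType} {T : topologicalType} n
    (a : 'I_n -> T -> R) :
  (forall k, continuous (a k)) ->
  continuous (fun t => \row_k a k t : 'rV[R]_n)%R.
Proof.
move=> ca t A [P aP PA].
have : \forall s \near t, forall k, P ord0 k (a k s).
  apply: filter_forall => k; apply: ca.
  by have := aP ord0 k; rewrite mxE.
by apply: filterS => s Ps; apply: PA => i j; rewrite mxE (ord1 i).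
Qed.

(** The weak topology of the continuous functions is coarser than that of [T], so functions locally
    equal to continuous ones are continuous. For composition, order [0] of smoothness is already
    continuity. *)
Lemma diff_structure_continuous {R : realType} (T : topologicalType) :
  diff_structure [set f : T -> R | continuous f].
Proof.
split=> [f fP t|n w a sw ca] /=; last first.
  move=> t; apply: continuous_comp; first exact: continuous_row.
  exact: (sw 0%N).1.
have [V [a [tV ca fa]]] := fP t.
have {}tV : nbhs t V.
  suff: continuous (id : T -> fun_top [set f : T -> R | continuous f]).
    by move=> /(_ t); exact.
  exact: continuous_fun_top.
have ft : f t = a t.
  apply: fa; exact: (nbhs_singleton tV).
rewrite /continuous_at ft.
apply: cvg_trans (ca t).
by apply: near_eq_cvg; apply: filterS tV => s /fa.
Qed.

(** * The uniformity of the generators and its completion *)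

Lemma fun_unif_continuous {R : realType} {M : choiceType} (G : set (M -> R))
    (g : M -> R) :
  G g -> unif_continuous (g : fun_unif G -> R).
Proof.
move=> Gg E; rewrite -entourage_ballE => -[e /= e0 eE].
exists 1%N, (fun=> g), e; split=> //= -[x y] /= xy.
by apply: eE; exact: (xy ord0).
Qed.

(* Both the entourage [E'] and the tolerance [e / 3] are cut in three: [v] and
   [w] are first replaced by nearby points of [M]. *)
Lemma completion_initial {R : realType} {M : choiceType} (G : set (M -> R))
    {V : uniformType} (i : fun_unif G -> V) (Gt : set (V -> R)) :
  @entourage (fun_unif G) = @entourage (initial_topology i) ->
  dense (range i) ->
  (forall gt, Gt gt -> continuous gt) ->
  (forall g, G g -> exists2 gt, Gt gt & gt \o i = g) ->
  continuous (id : fun_top Gt -> V).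
Proof.
move=> eU di Gtc ext v A vA.
have : @nbhs V V v A by [].
rewrite -nbhs_entourageE => -[E entE EA].
have [E' [entE' sE' E'E]] := ent_sym3 entE.
(* The trace of [E'] on [M] contains a basic entourage, given by finitely many [f j] in [G] and a
   tolerance [e]. Finiteness lets the extensions [ft j] cut out a neighbourhood of [v]. *)
have : @entourage (fun_unif G) [set xy | E' (i xy.1, i xy.2)].
  by rewrite eU; exists E'.
move=> [k [f [e [Gf e0 fE']]]].
have /choice[ft ftP] j : exists gt, Gt gt /\ gt \o i = f j.
  by have [gt Ggt gti] := ext _ (Gf j); exists gt.
have ftE j x : ft j (i x) = f j x by exact: (congr1 (@^~ x) (ftP j).2).
have e3 : (0 < e / 3)%R by rewrite divr_gt0.
have approx (w : V) : exists x, E' (w, i x) /\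
    forall j, (`|ft j w - f j x| < e / 3)%R.
  have H1 : nbhs w (xsection E' w) by exact: nbhs_entourage.
  have H2 : \forall u \near w, forall j, (`|ft j w - ft j u| < e / 3)%R.
    apply: filter_forall => j.
    by have /cvgrPdist_lt := Gtc _ (ftP j).1 w; apply.
  have [x [/xsectionP H3 H4]] := dense_range_nbhs i w _ di (filterI H1 H2).
  by exists x; split=> // j; rewrite -ftE.
have : nbhs (v : fun_top Gt) [set w | forall j, (`|ft j v - ft j w| < e / 3)%R].
  apply: (@filter_forall (fun_top Gt) _ _ _ (nbhs_filter v)) => j.
  by have /cvgrPdist_lt := @fun_top_continuous _ _ Gt _ (ftP j).1 v; apply.
apply: filterS => w vw; apply: EA; apply/xsectionP.
have [x [vx fx]] := approx v; have [y [wy fy]] := approx w.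
apply: (E'E _ (i x) (i y)) => //; last exact: sE'.
apply: (fE' (x, y)) => j /=.
have := fx j; have := fy j; have := vw j.
rewrite !ltr_norml => /andP[? ?] /andP[? ?] /andP[? ?].
by apply/andP; split; lra.
Qed.

Theorem proposition3p7 (R : realType) (M : choiceType)
    (C G : set (M -> R))
    (M_nonempty : [set: M] !=set0)
    (C_struct : diff_structure C)
    (C_hausdorff : hausdorff_space (fun_top C))
    (C_gen : C = gen G)
    (Mt : uniformType) (i : fun_unif G -> Mt)
    (i_completion : is_completion i) :
  (forall g : M -> R, G g ->
     exists! gt : Mt -> R, continuous gt /\ gt \o i = g) /\
  (let Gt : set (Mt -> R) :=
     [set gt | continuous gt /\ exists2 g, G g & gt \o i = g] in
   let D : set (Mt -> R) := gen Gt in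
   is_continuous_extension (M := M) i C D /\
   tau D = @open Mt).
Proof.
have [_ eU di _ _] := i_completion.
have ext (g : M -> R) : G g -> exists gt : Mt -> R, continuous gt /\ gt \o i = g.
  move=> /fun_unif_continuous/(dense_uniform_extension i g eU di).
  by move=> /(_ (@norm_hausdorff _ _))[gt cgt gti]; exists gt.
split.
  move=> g /ext[gt [cgt gti]]; exists gt; split=> // h [ch hi].
  by apply: (dense_range_continuous_inj i) => //; rewrite gti.
move=> Gt D.
have GtD : Gt `<=` D by exact: sub_gen_smallest.
have Dc : D `<=` [set f | continuous f].
  by apply: smallest_sub; [exact: diff_structure_continuous|move=> gt []].
have Gt_ext g : G g -> exists2 gt, Gt gt & gt \o i = g.
  by move=> Gg; have [gt [cgt gti]] := ext g Gg; exists gt => //; split=> //; exists g.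
split; last first.
  apply/seteqP; split=> A oA.
    have /continuousP : continuous (id : Mt -> fun_top D).
      exact: continuous_fun_top.
    by apply.
  have /continuousP : continuous (id : fun_top D -> Mt).
    (* The lemma is applied to [D] itself in place of [Gt]: its members are continuous by [Dc], and
       it contains the extensions. *)
    apply: (completion_initial G i) => // g /Gt_ext[gt Ggt gti].
    by exists gt => //; exact: GtD.
  by apply.
split=> //; split=> //; first exact: diff_structure_gen.
apply/seteqP; split.
  rewrite C_gen; apply: smallest_sub; first exact: diff_structure_gen.
  move=> g /Gt_ext[gt Ggt gti]; apply: sub_gen_smallest.
  by exists gt => //; exact: GtD.
(* Members of [Gt] restrict to members of [G], and minimality of [D] carries this over to
   restrictions in [C]. As [C] is a differential structure, it then contains all that these
   restrictions generate. *)
have DC : D `<=` [set b : Mt -> R | C (b \o i)].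
  apply: smallest_sub; first exact: diff_structure_pullback.
  by move=> _ [_ [g Gg /= ->]]; rewrite C_gen; exact: sub_gen_smallest.
by apply: smallest_sub => // _ [a /DC Ca <-].
Qed.
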